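(* A finite quasi-metric space is determined up to isometry by its magnitude cohomology ring: if $X$ and $X'$ are finite quasi-metric spaces and $\mathrm{MH}^*_*(X)\cong\mathrm{MH}^*_*(X')$ as bigraded rings, then $X$ and $X'$ are isometric.
   Context: A quasi-metric space is a set $X$ with a function $d\colon X\times X\to[0,\infty)$ such that $d(a,b)=0$ if and only if $a=b$, and $d(a,c)\leq d(a,b)+d(b,c)$ for all $a,b,c$ (symmetry is not required). An isometry is a distance-preserving bijection. A $k$-simplex ($k\ge 0$) in $X$ is a tuple $(x_0,\ldots,x_k)\in X^{k+1}$ with $x_{i-1}\neq x_i$ for all $i$; its length is $\ell(x_0,\ldots,x_k)=d(x_0,x_1)+\cdots+d(x_{k-1},x_k)$. For $\ell\in[0,\infty)$, $\mathrm{MC}_{k,\ell}(X)$ is the free abelian group on the $k$-simplices of length $\ell$, with differential $\partial=\sum_{i=1}^{k-1}(-1)^i\partial_i\colon \mathrm{MC}_{k,\ell}(X)\to\mathrm{MC}_{k-1,\ell}(X)$, where $\partial_i(x_0,\ldots,x_k)=(x_0,\ldots,\widehat{x_i},\ldots,x_k)$ if $d(x_{i-1},x_{i+1})=d(x_{i-1},x_i)+d(x_i,x_{i+1})$ and $0$ otherwise. The magnitude cochain complex is $\mathrm{MC}^k_\ell(X)=\mathrm{Hom}(\mathrm{MC}_{k,\ell}(X),\mathbb{Z})$ with differential $\partial^*\varphi=\varphi\circ\partial$, and $\mathrm{MH}^k_\ell(X)=H^k(\mathrm{MC}^*_\ell(X))$. For $\varphi\in\mathrm{MC}^{k_1}_{\ell_1}(X)$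 and $\psi\in\mathrm{MC}^{k_2}_{\ell_2}(X)$, the product $\varphi\cdot\psi\in\mathrm{MC}^{k_1+k_2}_{\ell_1+\ell_2}(X)$ sends a simplex $(x_0,\ldots,x_{k_1+k_2})$ of length $\ell_1+\ell_2$ to $\varphi(x_0,\ldots,x_{k_1})\,\psi(x_{k_1},\ldots,x_{k_1+k_2})$ if $\ell(x_0,\ldots,x_{k_1})=\ell_1$ and $\ell(x_{k_1},\ldots,x_{k_1+k_2})=\ell_2$, and to $0$ otherwise. The unit is the cochain $u\in\mathrm{MC}^0_0(X)$ with $u(x_0)=1$ for every $0$-simplex. This satisfies the Leibniz rule and makes $\mathrm{MH}^*_*(X)$ into an associative unital bigraded ring, the magnitude cohomology ring of $X$. An isomorphism of bigraded rings preserves both gradings. *)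

(* Defs.v *)
From HB Require Import structures.
From mathcomp Require Import all_boot all_order all_algebra generic_quotient.
From mathcomp Require Import interval_inference ring_quotient.
From mathcomp Require Import boolp reals.
From mathcomp Require Import freeg.

Set Implicit Arguments.
Unset Strict Implicit.
Unset Printing Implicit Defensive.

Import Order.TTheory GRing.Theory Num.Theory.

Local Open Scope ring_scope.
Local Open Scope quotient_scope.

HB.instance Definition _ (G : nzRingType) (K : choiceType) (M : lmodType G)
    (f : K -> M) :=
  GRing.isZmodMorphism.Build {freeg K / G} M (fglift f) (lift_is_additive f).

Section HomGroup.
Variables U V : zmodType.
Implicit Types f g h : {additive U -> V}.

Lemma additive_ext f g : f =1 g -> f = g.
Proof.
case: f g => [f [[F]]] [g [[G]]] /= fg.
have e : f = g by apply: funext.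
by subst g; rewrite (Prop_irrelevance F G).
Qed.

Definition hom_zero : {additive U -> V} := \0.
Definition hom_opp f : {additive U -> V} := \- f.
Definition hom_add f g : {additive U -> V} := f \+ g.

Lemma hom_addA : associative hom_add.
Proof. by move=> f g h; apply: additive_ext => x /=; rewrite addrA. Qed.
Lemma hom_addC : commutative hom_add.
Proof. by move=> f g; apply: additive_ext => x /=; rewrite addrC. Qed.
Lemma hom_add0 : left_id hom_zero hom_add.
Proof. by move=> f; apply: additive_ext => x /=; rewrite add0r. Qed.
Lemma hom_addN : left_inverse hom_zero hom_opp hom_add.
Proof. by move=> f; apply: additive_ext => x /=; rewrite addNr. Qed.

HB.instance Definition _ := gen_eqMixin {additive U -> V}.
HB.instance Definition _ := gen_choiceMixin {additive U -> V}.
HB.instance Definition _ := GRing.isZmodule.Build {additive U -> V}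
  hom_addA hom_addC hom_add0 hom_addN.
End HomGroup.

Record quasiMetric (R : realType) (X : Type) := QuasiMetric {
  dist :> X -> X -> R;
  dist_ge0 : forall a b, 0 <= dist a b;
  dist_eq0 : forall a b, dist a b = 0 <-> a = b;
  dist_triangle : forall a b c, dist a c <= dist a b + dist b c
}.

Definition isometric (R : realType) (X X' : Type)
    (d : quasiMetric R X) (d' : quasiMetric R X') : Prop :=
  exists f : X -> X', bijective f /\ forall a b, d' (f a) (f b) = d a b.

Section MagnitudeComplex.
Variables (R : realType) (X : choiceType) (d : quasiMetric R X).
Implicit Types (k i : nat) (l : {nonneg R}) (s : seq X).

Definition len s : R :=
  if s is x :: s' then \sum_(r <- pairmap d x s') r else 0.

Definition is_simplex k l s : bool :=
  [&& size s == k.+1, sorted (fun x y => x != y) s & len s == l%:num].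

(* A tuple (x_0, ..., x_k) is a sequence of size k+1; x_i is nth _ s i. *)
Record simplex k l :=
  Simplex { vertices :> seq X; _ : is_simplex k l vertices }.

HB.instance Definition _ k l := [isSub for @vertices k l].
HB.instance Definition _ k l := [Choice of simplex k l by <:].

Definition MC k l := {freeg (simplex k l) / int}.
HB.instance Definition _ k l := GRing.Lmodule.on (MC k l).

(* The generator of MC k l given by s, or 0 when s is not a k-simplex of
   length l. *)
Definition gen k l s : MC k l :=
  if insub s is Some x then Freeg [:: (1, x : simplex k l)] else 0.

(* For 0 < i < k: x_i lies between its two neighbours. *)
Definition smooth i s : bool :=
  if s is x0 :: _ then
    let x j := nth x0 s j in
    d (x i.-1) (x i.+1) == d (x i.-1) (x i) + d (x i) (x i.+1)
  else false.

Definition del i s : seq X := take i s ++ drop i.+1 s.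

(* For 0 < i < k.+1 the sequence del i x is a simplex of the same length
   (lemma is_simplex_del), so gen does not return its default 0. *)
Definition face k l i (x : simplex k.+1 l) : MC k l :=
  if smooth i x then gen k l (del i x) else 0.

Definition boundary k l : {additive MC k.+1 l -> MC k l} :=
  fglift (fun x : simplex k.+1 l =>
            \sum_(1 <= i < k.+1) (-1) ^+ i *: face i x).

Definition MCo k l := {additive MC k l -> int}.
HB.instance Definition _ k l := GRing.Zmodule.on (MCo k l).

Definition coboundary k l (phi : MCo k l) : MCo k.+1 l :=
  phi \o boundary k l.

(* In degree 0 the incoming differential comes from the zero group. *)
Definition is_coboundary k l : MCo k l -> Prop :=
  match k with
  | 0%N => fun phi => phi = 0
  | j.+1 => fun phi => exists psi : MCo j l, phi = coboundary psi
  end.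

(* The value on the tuple s, read as 0 off the simplices of MC k l. *)
Definition ev k l (phi : MCo k l) s : int := phi (gen k l s).

Lemma fglift_gen k l (M : lmodType int) (f : simplex k l -> M) x :
  fglift f (Freeg [:: (1, x)]) = f x.
Proof. by rewrite liftU scale1r. Qed.

Lemma genE k l (x : simplex k l) : gen k l x = Freeg [:: (1, x)].
Proof. by rewrite /gen valK. Qed.

(* The homomorphism with prescribed values on the simplices. *)
Definition linext k l (f : simplex k l -> int) : MCo k l :=
  (fglift (f : _ -> int^o) : {additive _ -> int^o}).

Definition addnng l1 l2 : {nonneg R} := (l1%:num + l2%:num)%:nng.

Definition cup k1 k2 l1 l2 (phi : MCo k1 l1) (psi : MCo k2 l2) :
    MCo (k1 + k2) (addnng l1 l2) :=
  linext (fun x =>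
    if (len (take k1.+1 x) == l1%:num) && (len (drop k1 x) == l2%:num)
    then ev phi (take k1.+1 x) * ev psi (drop k1 x) else 0).

Definition zeronng : {nonneg R} := 0%:nng.

Definition unit_cochain : MCo 0 zeronng := linext (fun _ => 1).

Lemma linextE k l (f : simplex k l -> int) (x : simplex k l) :
  ev (linext f) x = f x.
Proof. by rewrite /ev genE; exact: (@fglift_gen _ _ int^o). Qed.

Lemma MC_ind k l (P : MC k l -> Prop) :
  (forall x : simplex k l, P (gen k l x)) -> P 0 ->
  (forall u v, P u -> P v -> P (u + v)) -> (forall u, P u -> P (- u)) ->
  forall u, P u.
Proof.
move=> Pg P0 PD PN u; rewrite -(freeg_sumE u).
apply: (big_ind P) => // x _.
have Pn n : P (Freeg [:: (n%:Z, x)]).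
  elim: n => [|n IHn]; first by rewrite freegU0.
  by rewrite intS -freegUD; apply: PD => //; rewrite -genE.
by case: (coeff x u) => n //; rewrite NegzE -freegUN; apply: PN.
Qed.

Lemma MCo_ext k l (phi psi : MCo k l) : (forall s, ev phi s = ev psi s) -> phi = psi.
Proof.
move=> e; apply: additive_ext; apply: MC_ind => [x||u v eu ev|u eu].
- exact: e.
- by rewrite !raddf0.
- by rewrite !raddfD eu ev.
- by rewrite !raddfN eu.
Qed.

Lemma gen_out k l s : ~~ is_simplex k l s -> gen k l s = 0.
Proof. by move=> ns; rewrite /gen insubN. Qed.

Lemma ev_out k l (phi : MCo k l) s : ~~ is_simplex k l s -> ev phi s = 0.
Proof. by move=> ns; rewrite /ev gen_out // raddf0. Qed.

Lemma evD k l (phi psi : MCo k l) s : ev (phi + psi) s = ev phi s + ev psi s.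
Proof. by []. Qed.
Lemma evN k l (phi : MCo k l) s : ev (- phi) s = - ev phi s.
Proof. by []. Qed.
Lemma ev0 k l s : ev (0 : MCo k l) s = 0.
Proof. by []. Qed.

Lemma len_cat x s y t : len (x :: s ++ y :: t) =
  len (x :: s) + d (last x s) y + len (y :: t).
Proof. by rewrite /len pairmap_cat big_cat /= big_cons addrA. Qed.

Lemma smooth_split i s : (0 < i)%N -> (i.+1 < size s)%N -> exists s1 x y z s2,
  [/\ s = s1 ++ [:: x, y, z & s2], size s1 = i.-1 &
     smooth i s = (d x z == d x y + d y z)].
Proof.
case: i => // i _ lts; case: s lts => // x0 s' lts; set s := x0 :: s'.
have e : s = take i s ++ [:: nth x0 s i, nth x0 s i.+1, nth x0 s i.+2 & drop i.+3 s].
  by rewrite -!drop_nth ?cat_take_drop //; apply: leq_trans lts; rewrite ltnS // ltnW.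
exists (take i s), (nth x0 s i), (nth x0 s i.+1), (nth x0 s i.+2), (drop i.+3 s).
by split => //; rewrite size_takel // ltnW // ltnW // ltnW.
Qed.

Lemma del_sorted i s : sorted (fun x y => x != y) s ->
  (0 < i)%N -> (i.+1 < size s)%N -> smooth i s ->
  [/\ sorted (fun x y => x != y) (del i s), len (del i s) = len s &
      size (del i s) = (size s).-1].
Proof.
move=> ss i0 lis; have [s1 [x [y [z [s2 [es si ->]]]]]] := smooth_split i0 lis.
case: i i0 si {lis} => // i _ /= si /eqP dxz.
have -> : del i.+1 s = s1 ++ [:: x, z & s2].
  rewrite /del es take_cat drop_cat si !ltnNge leqnSn (leqW (leqnSn i)) /=.
  by rewrite subSnn -(addn2 i) addKn /= -catA.
have nxz : x != y -> x != z.
  move=> nxy; apply/eqP => exz.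
  have := dist_ge0 d y z; have := dist_ge0 d x y => h1 h2.
  have /eqP : d x y + d y z = 0 by rewrite -dxz; apply/dist_eq0.
  by rewrite paddr_eq0 // => /andP[/eqP/dist_eq0 e _]; rewrite e eqxx in nxy.
move: ss; rewrite es; split.
- case: s1 es si ss => [|a s1] _ _ /=.
    by case/and3P => [/nxz -> _ ->].
  by rewrite !cat_path /= => /and5P[-> -> /nxz -> _ ->].
- case: s1 {es si ss} => [|a s1]; rewrite /= ?pairmap_cat ?big_cat /= !big_cons.
    by rewrite dxz addrA.
  by rewrite dxz !addrA.
- by rewrite !size_cat /= !addnS.
Qed.

Lemma is_simplex_del k l i s : is_simplex k.+1 l s ->
  (0 < i < k.+1)%N -> smooth i s -> is_simplex k l (del i s).
Proof.
case/and3P => /eqP sz ss /eqP ls /andP[i0 ik] sm.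
have [||h1 h2 h3] := del_sorted ss _ _ sm => //; first by rewrite sz.
by rewrite /is_simplex h1 h2 h3 sz ls !eqxx.
Qed.

Lemma ev_coboundary k l (phi : MCo k l) s :
  size s = k.+2 -> sorted (fun x y => x != y) s ->
  ev (coboundary phi) s =
  \sum_(1 <= i < k.+1) (-1) ^+ i * (if smooth i s then ev phi (del i s) else 0).
Proof.
move=> sz ss; case: (eqVneq (len s) l%:num) => [ls|nls]; last first.
  rewrite ev_out; last by rewrite /is_simplex (negbTE nls) !andbF.
  rewrite big_nat big1 // => i /andP[i1 ik]; case: ifP => sm; last by rewrite mulr0.
  rewrite ev_out ?mulr0 //.
  have [||_ h _] := del_sorted ss _ _ sm => //; first by rewrite sz.
  by rewrite /is_simplex h (negbTE nls) !andbF.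
have simp : is_simplex k.+1 l s by rewrite /is_simplex sz ss ls !eqxx.
rewrite -[s]/(vertices (Simplex simp)) /ev genE /coboundary /= fglift_gen raddf_sum.
apply: eq_bigr => i _; rewrite -[_ *: _]/(_ *: face i _).
have -> n (c : MC k l) : phi ((-1) ^+ n *: c) = (-1) ^+ n * phi c.
  by rewrite -signr_odd; case: odd; rewrite ?scaleN1r ?mulN1r ?raddfN ?scale1r ?mul1r.
by rewrite /face /=; case: ifP => // _; rewrite raddf0.
Qed.

Lemma cupE k1 k2 l1 l2 (phi : MCo k1 l1) (psi : MCo k2 l2) s :
  ev (cup phi psi) s = ev phi (take k1.+1 s) * ev psi (drop k1 s).
Proof.
case: (boolP (is_simplex (k1 + k2) (addnng l1 l2) s)) => [simp|nsimp].
  rewrite -[s]/(vertices (Simplex simp)) linextE /=.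
  case: ifPn => //; rewrite negb_and => /orP[] h.
    by rewrite ev_out ?mul0r // /is_simplex (negbTE h) !andbF.
  by rewrite [ev psi _]ev_out ?mulr0 // /is_simplex (negbTE h) !andbF.
rewrite ev_out //; apply/esym/eqP; rewrite mulf_eq0; apply: contraNT nsimp.
rewrite negb_or => /andP[h1 h2].
have /and3P[/eqP z1 s1 /eqP n1] : is_simplex k1 l1 (take k1.+1 s).
  by apply: contraNT h1 => h; rewrite ev_out.
have /and3P[/eqP z2 s2 /eqP n2] : is_simplex k2 l2 (drop k1 s).
  by apply: contraNT h2 => h; rewrite ev_out.
have ks : (k1 < size s)%N.
  by move: z1; rewrite size_take; case: ltnP => [/ltnW|_ ->].
have sz : size s = (k1 + k2).+1.
  by move: z2; rewrite size_drop => /(congr1 (addn k1)); rewrite subnKC ?addnS // ltnW.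
have [x0 _] : exists x0 : X, True by case: (s) ks => // x0 *; exists x0.
have e1 : take k1.+1 s = rcons (take k1 s) (nth x0 s k1) by rewrite -take_nth.
have e2 : drop k1 s = nth x0 s k1 :: drop k1.+1 s by rewrite -drop_nth.
have es : s = take k1 s ++ nth x0 s k1 :: drop k1.+1 s by rewrite -e2 cat_take_drop.
move: s1 s2 n1 n2; rewrite e1 e2 => s1 s2 n1 n2.
rewrite /is_simplex sz eqxx /= es -[(addnng l1 l2)%:num]/(l1%:num + l2%:num).
rewrite -n1 -n2; move: (take k1 s) (nth x0 s k1) (drop k1.+1 s) s1 s2 => [|a u] x v /=.
  by rewrite big_nil add0r eqxx andbT.
rewrite rcons_path cat_path /= => /andP[-> ->] ->.
by rewrite -cats1 !pairmap_cat !big_cat /= !big_cons big_nil addr0 addrA eqxx.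
Qed.

Lemma smoothE (x0 : X) i s : (i.+1 < size s)%N -> smooth i s =
  (d (nth x0 s i.-1) (nth x0 s i.+1) ==
   d (nth x0 s i.-1) (nth x0 s i) + d (nth x0 s i) (nth x0 s i.+1)).
Proof.
case: s => [|a t] // lis; rewrite /smooth.
have e k : (k <= i.+1)%N -> nth a (a :: t) k = nth x0 (a :: t) k.
  by move=> ki; apply: set_nth_default; apply: leq_ltn_trans lis.
by rewrite !e // (leq_trans (leq_pred i)).
Qed.

Lemma smooth_take (x0 : X) n i s : (i.+1 < n)%N -> (n <= size s)%N ->
  smooth i (take n s) = smooth i s.
Proof.
move=> lin lns; rewrite !(smoothE x0) ?size_takel ?(leq_trans lin) //.
by rewrite !nth_take // ?(leq_ltn_trans (leq_pred i)) // ltnW.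
Qed.

Lemma smooth_drop (x0 : X) n j s : (0 < j)%N -> (n + j.+1 < size s)%N ->
  smooth (n + j) s = smooth j (drop n s).
Proof.
case: j => // j _ lts; rewrite !(smoothE x0) ?size_drop ?ltn_subRL -?addnS //.
- by rewrite !nth_drop addnS.
- by rewrite addnS.
- by rewrite addnS.
Qed.

Lemma take_del_lo n i s : (i <= n)%N -> (n < size s)%N ->
  take n (del i s) = del i (take n.+1 s).
Proof.
move=> lin lns; rewrite /del take_cat size_takel; last by rewrite ltnW // (leq_ltn_trans lin).
rewrite ltnNge lin /= take_takel 1?leqW //; congr (_ ++ _).
by rewrite take_drop addnS subnK.
Qed.

Lemma drop_del_lo n i s : (i <= n)%N -> (n < size s)%N ->
  drop n (del i s) = drop n.+1 s.
Proof.
move=> lin lns; rewrite /del drop_cat size_takel; last by rewrite ltnW // (leq_ltn_trans lin).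
by rewrite ltnNge lin /= drop_drop addnS subnK.
Qed.

Lemma take_del_hi n j s : (0 < j)%N -> (n + j < size s)%N ->
  take n.+1 (del (n + j) s) = take n.+1 s.
Proof.
move=> j0 lns; have h : (n < n + j)%N by rewrite -addn1 leq_add2l.
by rewrite /del takel_cat ?take_takel // size_takel // ltnW.
Qed.

Lemma drop_del_hi n j s : (0 < j)%N -> (n + j < size s)%N ->
  drop n (del (n + j) s) = del j (drop n s).
Proof.
move=> j0 lns; rewrite /del drop_cat size_takel; last exact: ltnW.
by rewrite -[X in (X < _)%N]addn0 ltn_add2l j0 take_drop addnC drop_drop addSn.
Qed.

Lemma leibniz k1 k2 l1 l2 (phi : MCo k1 l1) (psi : MCo k2 l2) s :
  ev (coboundary (cup phi psi)) s =
  ev (cup (coboundary phi) psi) s + (-1) ^+ k1 * ev (cup phi (coboundary psi)) s.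
Proof.
case: (boolP ((size s == (k1 + k2).+2) && sorted (fun x y => x != y) s)); last first.
  rewrite negb_and => ns; rewrite !ev_out ?mulr0 ?addr0 //.
  - by rewrite /is_simplex addnS; case/orP: ns => /negbTE ->; rewrite ?andbF.
  - by rewrite /is_simplex addSn; case/orP: ns => /negbTE ->; rewrite ?andbF.
  - by rewrite /is_simplex; case/orP: ns => /negbTE ->; rewrite ?andbF.
case/andP => /eqP sz ss.
have sz1 : size (take k1.+2 s) = k1.+2 by rewrite size_takel // sz !ltnS leq_addr.
have sz2 : size (drop k1 s) = k2.+2 by rewrite size_drop sz -!addnS addKn.
have x0 : X by case: (s) sz.
rewrite ev_coboundary // (cupE (coboundary phi)) (cupE phi (coboundary psi)).
rewrite (ev_coboundary phi) ?take_sorted // (ev_coboundary psi) ?drop_sorted //.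
rewrite mulr_suml.
rewrite (@big_cat_nat _ _ _ k1.+1) ?ltnS ?leq_addr //; congr (_ + _).
  apply: eq_big_nat => i /andP[i1 ik]; rewrite -mulrA; congr (_ * _).
  rewrite (smooth_take x0) ?sz ?ltnS ?leq_addr //; case: (smooth i s); last by rewrite mul0r.
  by rewrite cupE take_del_lo ?drop_del_lo ?sz ?ltnS ?leqW ?leq_addr. 
rewrite -{1}[k1.+1]add1n big_addn subSn ?leq_addr // addKn.
rewrite !mulr_sumr; apply: eq_big_nat => j /andP[j1 jk]; rewrite addnC exprD -mulrA.
congr (_ * _); rewrite mulrCA; congr (_ * _).
rewrite (smooth_drop x0) ?sz ?ltnS -?addnS ?leq_add2l //; case: (smooth j _); last by rewrite mulr0.
by rewrite cupE take_del_hi ?drop_del_hi ?sz ?ltnS ?leqW ?leq_add2l.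
Qed.

Definition cocycle k l : {pred MCo k l} := fun phi => coboundary phi == 0.

Lemma coboundary_additive k l : zmod_morphism (@coboundary k l).
Proof. by move=> phi psi; apply: additive_ext. Qed.

HB.instance Definition _ k l := GRing.isZmodMorphism.Build
  (MCo k l) (MCo k.+1 l) (@coboundary k l) (@coboundary_additive k l).

Lemma cocycleE k l (phi : MCo k l) :
  (phi \in @cocycle k l) = (coboundary phi == 0).
Proof. by []. Qed.

Lemma coboundaryB k l : {morph (@coboundary k l) : phi psi / phi - psi}.
Proof. exact: coboundary_additive. Qed.

Lemma cocycle_closed k l : zmod_closed (@cocycle k l).
Proof.
split=> [|phi psi]; rewrite !cocycleE; first by rewrite raddf0.
by rewrite coboundaryB => /eqP -> /eqP ->; rewrite subrr.
Qed.

HB.instance Definition _ k l :=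
  GRing.isZmodClosed.Build (MCo k l) (@cocycle k l) (@cocycle_closed k l).

Record MZ k l := Cocycle { cochain :> MCo k l; _ : cochain \in @cocycle k l }.

HB.instance Definition _ k l := [isSub for @cochain k l].
HB.instance Definition _ k l := [Choice of MZ k l by <:].
HB.instance Definition _ k l := [SubChoice_isSubZmodule of MZ k l by <:].

Definition MB k l : {pred MZ k l} := fun z => `[< is_coboundary (cochain z) >].

Lemma is_coboundaryB k l (phi psi : MCo k l) :
  is_coboundary phi -> is_coboundary psi -> is_coboundary (phi - psi).
Proof.
case: k phi psi => [|k] phi psi /=; first by move=> -> ->; rewrite subrr.
by case=> a -> [b ->]; exists (a - b); rewrite coboundaryB.
Qed.

Lemma is_coboundary0 k l : is_coboundary (0 : MCo k l).
Proof. by case: k => [|k] //=; exists 0; rewrite raddf0. Qed.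

Lemma MB_P k l (z : MZ k l) :
  reflect (is_coboundary (cochain z)) (z \in @MB k l).
Proof. exact: asboolP. Qed.

Lemma MB_closed k l : zmod_closed (@MB k l).
Proof.
split=> [|z w]; first exact/MB_P/is_coboundary0.
by move=> /MB_P bz /MB_P bw; exact/MB_P/is_coboundaryB.
Qed.

HB.instance Definition _ k l :=
  GRing.isZmodClosed.Build (MZ k l) (@MB k l) (@MB_closed k l).

Definition MH k l := {ideal_quot (@MB k l)}.
HB.instance Definition _ k l := GRing.Zmodule.on (MH k l).
HB.instance Definition _ k l := Quotient.on (MH k l).

Lemma cupBl k1 k2 l1 l2 (phi phi' : MCo k1 l1) (psi : MCo k2 l2) :
  cup (phi - phi') psi = cup phi psi - cup phi' psi.
Proof. by apply: MCo_ext => s; rewrite evD evN !cupE evD evN mulrBl. Qed.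

Lemma cupBr k1 k2 l1 l2 (phi : MCo k1 l1) (psi psi' : MCo k2 l2) :
  cup phi (psi - psi') = cup phi psi - cup phi psi'.
Proof. by apply: MCo_ext => s; rewrite evD evN !cupE evD evN mulrBr. Qed.

Lemma cup0l k1 k2 l1 l2 (psi : MCo k2 l2) : cup (0 : MCo k1 l1) psi = 0.
Proof. by apply: MCo_ext => s; rewrite cupE !ev0 mul0r. Qed.

Lemma cup0r k1 k2 l1 l2 (phi : MCo k1 l1) : cup phi (0 : MCo k2 l2) = 0.
Proof. by apply: MCo_ext => s; rewrite cupE !ev0 mulr0. Qed.

Lemma is_coboundaryP k l (phi : MCo k l) j (psi : MCo j l) : k = j.+1 ->
  (forall s, ev phi s = ev (coboundary psi) s) -> is_coboundary phi.
Proof. by move=> e; subst k => /MCo_ext ->; exists psi. Qed.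

Lemma is_coboundary_cupl k1 k2 l1 l2 (phi : MCo k1 l1) (psi : MCo k2 l2) :
  is_coboundary phi -> coboundary psi = 0 -> is_coboundary (cup phi psi).
Proof.
case: k1 phi => [|k1] phi; first by move=> -> _; rewrite cup0l; exact: is_coboundary0.
case=> phi' -> psi0; apply: (@is_coboundaryP _ _ _ _ (cup phi' psi)) => // s.
by rewrite leibniz psi0 cup0r ev0 mulr0 addr0.
Qed.

Lemma is_coboundary_cupr k1 k2 l1 l2 (phi : MCo k1 l1) (psi : MCo k2 l2) :
  coboundary phi = 0 -> is_coboundary psi -> is_coboundary (cup phi psi).
Proof.
case: k2 psi => [|k2] psi phi0; first by move=> ->; rewrite cup0r; exact: is_coboundary0.
case=> psi' ->.
pose eps (c : MCo (k1 + k2) (addnng l1 l2)) := if odd k1 then - c else c.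
apply: (@is_coboundaryP _ _ _ _ (eps (cup phi psi'))); first exact: addnS.
move=> s; have -> : coboundary (eps (cup phi psi')) =
    if odd k1 then - coboundary (cup phi psi') else coboundary (cup phi psi').
  by rewrite /eps; case: odd => //; rewrite -[in LHS]sub0r coboundaryB raddf0 sub0r.
have e := leibniz phi psi' s; rewrite phi0 cup0l ev0 add0r -signr_odd in e.
by case: odd e; rewrite ?evN => ->; rewrite ?mulN1r ?opprK ?mul1r.
Qed.

Lemma cocycleP k l (z : MZ k l) : coboundary (cochain z) = 0.
Proof. by apply/eqP; case: z. Qed.

Lemma cup_cocycle k1 k2 l1 l2 (z : MZ k1 l1) (w : MZ k2 l2) :
  cup (cochain z) (cochain w) \in @cocycle (k1 + k2) (addnng l1 l2).
Proof.
rewrite cocycleE; apply/eqP/MCo_ext => s.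
by rewrite leibniz !cocycleP cup0l cup0r !ev0 mulr0 addr0.
Qed.

Definition cupZ k1 k2 l1 l2 (z : MZ k1 l1) (w : MZ k2 l2) :
  MZ (k1 + k2) (addnng l1 l2) := Cocycle (cup_cocycle z w).

Lemma unit_cocycle : unit_cochain \in @cocycle 0 zeronng.
Proof.
rewrite cocycleE; apply/eqP/MCo_ext => s.
case: (boolP (is_simplex 1 zeronng s)) => [/and3P[/eqP ? ? _]|?].
  by rewrite ev_coboundary // big_geq.
by rewrite !ev_out.
Qed.

Definition unitH : MH 0 zeronng := \pi_(MH 0 zeronng) (Cocycle unit_cocycle).

Definition mulH k1 k2 l1 l2 (x : MH k1 l1) (y : MH k2 l2) :
  MH (k1 + k2) (addnng l1 l2) :=
  \pi_(MH (k1 + k2) (addnng l1 l2)) (cupZ (repr x) (repr y)).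

(* mulH is the product induced by the cup product of cocycles: it does not
   depend on the representatives. *)
Lemma mulH_pi k1 k2 l1 l2 (z : MZ k1 l1) (w : MZ k2 l2) :
  mulH (\pi_(MH k1 l1) z) (\pi_(MH k2 l2) w) =
  \pi_(MH (k1 + k2) (addnng l1 l2)) (cupZ z w).
Proof.
apply/eqP; rewrite /mulH -Quotient.idealrBE.
set z' := repr _; set w' := repr _.
have /MB_P bz : z' - z \in @MB k1 l1 by rewrite Quotient.idealrBE reprK.
have /MB_P bw : w' - w \in @MB k2 l2 by rewrite Quotient.idealrBE reprK.
apply/MB_P; have -> : cochain (cupZ z' w' - cupZ z w) =
    cup (cochain (z' - z)) (cochain w') - cup (cochain z) (cochain (w - w')).
  rewrite -![cochain _]/(val _) !raddfB /= cupBl cupBr.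
  by rewrite opprB addrA subrK.
apply: is_coboundaryB; first exact: is_coboundary_cupl bz (cocycleP _).
apply: is_coboundary_cupr (cocycleP _) _.
have -> : cochain (w - w') = 0 - cochain (w' - w).
  by rewrite sub0r -![cochain _]/(val _) -raddfN opprB.
exact: is_coboundaryB (is_coboundary0 _ _) bw.
Qed.
End MagnitudeComplex.

(* A map of bigraded rings preserving both gradings is the family of its
   homogeneous components. *)
Definition MH_ring_iso (R : realType) (X X' : choiceType)
    (d : quasiMetric R X) (d' : quasiMetric R X') : Prop :=
  exists f : forall k (l : {nonneg R}), {additive MH d k l -> MH d' k l},
    [/\ forall k l, bijective (f k l),
        f _ _ (unitH d) = unitH d' &
        forall k1 k2 l1 l2 (x : MH d k1 l1) (y : MH d k2 l2),
          f _ _ (mulH x y) = mulH (f _ _ x) (f _ _ y)].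

(* Main.v *)
From HB Require Import structures.
Require Import Defs.
From mathcomp Require Import all_boot all_order all_algebra reals.
From mathcomp Require Import generic_quotient ring_quotient interval_inference boolp.

Set Implicit Arguments.
Unset Strict Implicit.
Unset Printing Implicit Defensive.

Import Order.TTheory GRing.Theory Num.Theory.

Local Open Scope ring_scope.
Local Open Scope quotient_scope.

(** Only degrees zero and one of the ring matter.  There every coboundary
vanishes, so a class is a cocycle and can be evaluated on tuples; the values
of a product are products of values.

Degree zero carries the points: the classes [point a] are nonzero, mutually
orthogonal, and sum to the unit.  An injective homomorphism sends them to
integer-valued functions on [X'] with the same three properties.  At each point
[y] of [X'] these functions multiply pairwise to zero and sum to one, so exactly
one of them is nonzero at [y]; this defines [tau : X' -> X], which is onto
because no image vanishes.

Degree one carries the edges.  A pair [(a, b)] of distinct points is adjacent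
when no third point lies between them, and the one-cocycles of length [l] are
the functions supported on the adjacent pairs at distance [l]; so
[point a * z * point b] is nonzero for some class [z] of length [d a b]
([adjacent_class]).  The image of such a product is nonzero as well, and hence
is supported at a pair of points over [(a, b)], at the same distance
([class_edge], [edges_lift]).

Since [X] is finite, each distance is the length of a path of adjacent pairs, so
as soon as [tau] is injective it can only increase distances
([dist_le_pullback]).  The inverse isomorphism gives a map [tau' : X -> X'] of
the same kind.  Both are onto, hence bijective by counting, and comparing the
sums of all distances forces equality ([isometric_of_expanding]).  In
particular [tau'] is never compared with the inverse of [tau]. *)

(** * Cohomology in degrees zero and one *)

Section LowDegree.
Variables (R : realType) (X : choiceType) (d : quasiMetric R X).
Implicit Types (k : nat) (l : {nonneg R}) (s : seq X) (a b : X).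

(** The differential from degree zero to degree one is an empty sum: an edge has
no interior vertex. *)
Lemma low_coboundary_eq0 k l (phi : MCo d k l) :
  (k <= 1)%N -> is_coboundary phi -> phi = 0.
Proof.
case: k phi => [|[|k]] phi // _ [psi ->]; apply: MCo_ext => s; rewrite ev0.
have [/and3P[/eqP sz ss _]|ns] := boolP (is_simplex d 1 l s); last exact: ev_out.
by rewrite ev_coboundary // big_geq.
Qed.

(** A chosen representative is evaluated, so this is canonical only where
coboundaries vanish, that is for [k <= 1] (see [evH_pi]). *)
Definition evH k l (x : MH d k l) s : int := ev (cochain (repr x)) s.

Lemma evH_pi k l (z : MZ d k l) s :
  (k <= 1)%N -> evH (\pi_(MH d k l) z) s = ev (cochain z) s.
Proof.
move=> k1; have /MB_P b : repr (\pi_(MH d k l) z) - z \in @MB _ _ d k l.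
  by rewrite Quotient.idealrBE reprK.
have /(congr1 (fun phi => ev phi s)) := low_coboundary_eq0 k1 b.
by rewrite -[cochain _]/(val _) raddfB evD evN ev0 => /eqP; rewrite subr_eq0 => /eqP.
Qed.

Lemma evH0 k l s : (k <= 1)%N -> evH (0 : MH d k l) s = 0.
Proof. by move=> k1; rewrite -[0](raddf0 \pi_(MH d k l)) evH_pi. Qed.

Lemma evHD k l (x y : MH d k l) s :
  (k <= 1)%N -> evH (x + y) s = evH x s + evH y s.
Proof.
by move=> k1; rewrite -[x]reprK -[y]reprK -(raddfD \pi_(MH d k l)) !evH_pi.
Qed.

Lemma evH_sum k l (I : finType) (F : I -> MH d k l) s :
  (k <= 1)%N -> evH (\sum_i F i) s = \sum_i evH (F i) s.
Proof.
by move=> k1; apply: (big_morph (fun x => evH x s)) => [x y|]; rewrite ?evHD ?evH0.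
Qed.

Lemma evH_mul k1 k2 l1 l2 (x : MH d k1 l1) (y : MH d k2 l2) s :
  (k1 + k2 <= 1)%N ->
  evH (mulH x y) s = evH x (take k1.+1 s) * evH y (drop k1 s).
Proof. by move=> k1k2; rewrite /mulH evH_pi //; apply: cupE. Qed.

Lemma evH_simplex k l (x : MH d k l) s : evH x s != 0 -> is_simplex d k l s.
Proof. by apply: contraR => ns; rewrite /evH ev_out. Qed.

Lemma evH_ext k l (x y : MH d k l) : (forall s, evH x s = evH y s) -> x = y.
Proof.
move=> e; rewrite -[x]reprK -[y]reprK; congr (\pi_(MH d k l) _).
exact/val_inj/MCo_ext.
Qed.

Lemma evH_neq0 k l (x : MH d k l) : (k <= 1)%N -> x != 0 -> exists s, evH x s != 0.
Proof.
move=> k1 x0; apply: contrapT => nex; case/eqP: x0; apply: evH_ext => s.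
rewrite evH0 //; apply/eqP/negPn/negP => h.
by apply: nex; exists s.
Qed.

Lemma vertex_simplex a : is_simplex d 0 (zeronng R) [:: a].
Proof. by rewrite /is_simplex /len /= big_nil. Qed.

Lemma cochain0_cocycle l (phi : MCo d 0 l) : phi \in @cocycle _ _ d 0 l.
Proof.
rewrite cocycleE; apply/eqP/low_coboundary_eq0 => //.
by exists phi.
Qed.

(** The indicator cochain of the simplex [s]; it is zero when [s] is not a
simplex. *)
Definition dual k l s : MCo d k l :=
  linext (fun x : simplex d k l => (vertices x == s)%:R).

Lemma ev_dual k l s t : is_simplex d k l s -> ev (dual k l s) t = (t == s)%:R.
Proof.
move=> ss; have [st|nst] := boolP (is_simplex d k l t).
  by rewrite -[t]/(vertices (Simplex st)) linextE.
by rewrite ev_out //; case: eqP => // e; rewrite e ss in nst.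
Qed.

Definition point a : MH d 0 (zeronng R) :=
  \pi_(MH d 0 (zeronng R)) (Cocycle (cochain0_cocycle (dual 0 (zeronng R) [:: a]))).

Lemma evH_point a s : evH (point a) s = (s == [:: a])%:R.
Proof. by rewrite evH_pi // ev_dual // vertex_simplex. Qed.

Lemma point_neq0 a : point a != 0.
Proof.
apply/eqP => /(congr1 (fun x => evH x [:: a])).
by rewrite evH_point eqxx evH0.
Qed.

Lemma point_orthogonal a b : a != b -> mulH (point a) (point b) = 0.
Proof.
move=> ab; apply: evH_ext => s; rewrite evH0 // evH_mul // !evH_point drop0.
case: eqP => [t1|_]; last by rewrite mul0r.
case: eqP => [e|_]; last by rewrite mulr0.
by move: t1 ab; rewrite e /= => -[->]; rewrite eqxx.
Qed.

Lemma evH_unit a : evH (unitH d) [:: a] = 1.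
Proof.
by rewrite evH_pi //; apply: (linextE _ (Simplex (vertex_simplex a))).
Qed.

Definition between a b : pred X :=
  fun c => [&& c != a, c != b & d a b == d a c + d c b].

Definition adjacent a b : Prop := a != b /\ forall c, ~~ between a b c.

Lemma edge_simplex a b l :
  a != b -> l%:num = d a b -> is_simplex d 1 l [:: a; b].
Proof. by move=> ab lab; rewrite /is_simplex /= ab /len /= big_seq1 lab eqxx. Qed.

(** Deleting the middle vertex of a simplex [x, y, z] gives [a, b] with
nonzero coefficient only if [y] lies between [a] and [b]. *)
Lemma edge_cocycle a b l :
  adjacent a b -> l%:num = d a b -> dual 1 l [:: a; b] \in @cocycle _ _ d 1 l.
Proof.
move=> [ab nbet] lab; rewrite cocycleE; apply/eqP/MCo_ext => s; rewrite ev0.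
have [/and3P[/eqP sz ss _]|ns] := boolP (is_simplex d 2 l s); last exact: ev_out.
rewrite ev_coboundary // big_nat1 ev_dual; last exact: edge_simplex.
case: s sz ss => [|x [|y [|z []]]] // _ /=; rewrite andbT => /andP[xy yz].
case: ifP => xyz; last by rewrite mulr0.
case: eqP => [[ex ez]|_]; last by rewrite mulr0.
have /negP[] := nbet y.
by rewrite /between -ex -ez eq_sym xy yz.
Qed.

(** The class dual to the edge [a, b] takes the value one there, and multiplying
by the two points does not change that value. *)
Lemma adjacent_class a b l : adjacent a b -> l%:num = d a b ->
  exists z : MH d 1 l, mulH (mulH (point a) z) (point b) != 0.
Proof.
move=> adj lab; exists (\pi_(MH d 1 l) (Cocycle (edge_cocycle adj lab))).
apply/eqP => /(congr1 (fun x => evH x [:: a; b])).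
rewrite evH0 // !evH_mul // !evH_point evH_pi // ev_dual.
  by rewrite !eqxx.
by apply: edge_simplex => //; case: adj.
Qed.

(** The outer factors are arbitrary because a homomorphism may send a point to a
sum of several points.  On a tuple [a, b] the product is the product of the
values of [x] at [a], of [z] at [a, b] and of [y] at [b]. *)
Lemma class_edge (x : MH d 0 (zeronng R)) l (z : MH d 1 l)
    (y : MH d 0 (zeronng R)) : mulH (mulH x z) y != 0 ->
  exists a b, [/\ evH x [:: a] != 0, evH y [:: b] != 0 & d a b = l%:num].
Proof.
case/evH_neq0 => // s; rewrite !evH_mul // !mulf_eq0 !negb_or => /andP[/andP[xs zs] ys].
move: zs xs ys; rewrite drop0 => /evH_simplex /and3P[].
case: s => [|a [|b s]] //= _ _ /eqP lab.
move=> xa yb; exists a, b; split=> //; last by rewrite -lab take0 big_seq1.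
have /and3P[/eqP sz _ _] := evH_simplex yb.
by case: s sz yb {lab}.
Qed.

End LowDegree.

Lemma sum_points (R : realType) (X : finType) (d : quasiMetric R X) :
  \sum_a point d a = unitH d.
Proof.
apply: evH_ext => s; rewrite evH_sum //.
have [|ns] := boolP (is_simplex d 0 (zeronng R) s); last first.
  rewrite [RHS]ev_out // big1 // => a _; rewrite evH_point.
  by case: eqP => // e; rewrite e vertex_simplex in ns.
case/and3P; case: s => [|x []] // _ _ _; rewrite evH_unit (bigD1 x) //=.
rewrite evH_point eqxx big1 ?addr0 // => a ax.
by rewrite evH_point; case: eqP => // -[e]; rewrite e eqxx in ax.
Qed.

(** * Points and edges under an injective homomorphism *)

Section Injection.
Variables (R : realType) (X X' : finType).
Variables (d : quasiMetric R X) (d' : quasiMetric R X').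
Variable f : forall k (l : {nonneg R}), {additive MH d k l -> MH d' k l}.
Arguments f {k l}.
Hypothesis f_inj : forall k l, injective (@f k l).
Hypothesis f_unit : f (unitH d) = unitH d'.
Hypothesis f_mul : forall k1 k2 l1 l2 (x : MH d k1 l1) (y : MH d k2 l2),
  f (mulH x y) = mulH (f x) (f y).

Lemma f_neq0 k l (x : MH d k l) : x != 0 -> f x != 0.
Proof. by apply: contraNneq => e; apply/eqP/f_inj; rewrite e raddf0. Qed.

(** The images of the points sum to the unit, whose value at [y] is one. *)
Lemma point_over y : exists a, evH (f (point d a)) [:: y] != 0.
Proof.
apply: contrapT => nex; have := evH_unit d' y.
rewrite -f_unit -sum_points raddf_sum evH_sum // big1 // => a _.
by apply/eqP/negPn/negP => h; apply: nex; exists a.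
Qed.

(** Distinct points are orthogonal, so the images of two of them cannot both be
nonzero at [y], the integers being a domain. *)
Lemma point_over_unique y a b :
  evH (f (point d a)) [:: y] != 0 -> evH (f (point d b)) [:: y] != 0 -> a = b.
Proof.
move=> ya yb; apply/eqP; apply: contraTT ya => ab; apply: contraNN yb => ya.
have := evH_mul (f (point d a)) (f (point d b)) [:: y] isT.
rewrite -f_mul point_orthogonal // raddf0 evH0 //= => /esym/eqP.
by rewrite mulf_eq0 (negbTE ya).
Qed.

(** The map [tau] sends [y] to the point whose image is nonzero at [y].  Applying
the homomorphism to the product of [adjacent_class] moves each edge of [X] to
an edge lying over it. *)
Lemma edges_lift : exists tau : X' -> X,
  (forall a, exists y, tau y = a) /\
  forall a b, adjacent d a b ->
    exists y y', [/\ tau y = a, tau y' = b & d' y y' = d a b].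
Proof.
have [tau tauP] := choice point_over.
have tauE y a : evH (f (point d a)) [:: y] != 0 -> tau y = a.
  exact: point_over_unique (tauP y).
exists tau; split=> [a|a b adj].
  have [//|s ns] := evH_neq0 _ (f_neq0 (point_neq0 d a)).
  have /and3P[] := evH_simplex ns.
  by case: s ns => [|y []] // ns _ _ _; exists y; apply: tauE.
have [z /f_neq0] := adjacent_class (l := NngNum (dist_ge0 d a b)) adj erefl.
rewrite !f_mul => /class_edge[y [y' [/tauE ya /tauE yb dyy']]].
by exists y, y'.
Qed.

End Injection.

(** * Adjacent pairs determine the distance *)

Section Geodesics.
Variables (R : realType) (X : finType) (d : quasiMetric R X).

(** If [c] lies between [a] and [b], refining the segment from [a] to [c] refines
the segment from [a] to [b].  Here [x != b] because [x = b] would put [b]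
between [a] and [c], and then [d b c] and [d c b] would both be zero. *)
Lemma between_left a b c x :
  between d a b c -> between d a c x -> between d a b x.
Proof.
case/and3P => ca cb /eqP acb /and3P[xa xc /eqP axc].
have dax : d a b = d a x + d x b.
  apply/eqP; rewrite eq_le dist_triangle acb axc -addrA lerD2l.
  exact: dist_triangle.
apply/and3P; split=> //; last exact/eqP.
apply/eqP => xb; move: axc; rewrite xb acb -addrA => /eqP.
rewrite -subr_eq0 opprD addrA subrr sub0r oppr_eq0 paddr_eq0 ?dist_ge0 //.
by case/andP=> /eqP/dist_eq0 e; rewrite e eqxx in cb.
Qed.

Lemma between_right a b c x :
  between d a b c -> between d c b x -> between d a b x.
Proof.
case/and3P => ca cb /eqP acb /and3P[xc xb /eqP cxb].
have dax : d a b = d a x + d x b.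
  apply/eqP; rewrite eq_le dist_triangle acb cxb addrA lerD2r.
  exact: dist_triangle.
apply/and3P; split=> //; last exact/eqP.
apply/eqP => xa; move: cxb; rewrite xa acb addrA => /eqP.
rewrite -subr_eq0 opprD addrCA subrr addr0 oppr_eq0 paddr_eq0 ?dist_ge0 //.
by case/andP=> /eqP/dist_eq0 e; rewrite e eqxx in ca.
Qed.

(** By induction on the number of points between [a] and [b]: a point [c] between
them splits the pair into two, each with fewer points in between, as these are
again between [a] and [b] and differ from [c]. *)
Lemma le_dist_of_adjacent (D : X -> X -> R) :
  (forall a, D a a = 0) ->
  (forall a b c, D a c <= D a b + D b c) ->
  (forall a b, adjacent d a b -> D a b <= d a b) ->
  forall a b, D a b <= d a b.
Proof.
move=> D0 Dtri Dadj a b.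
have [n] := ubnP #|between d a b|; elim: n a b => // n IHn a b; rewrite ltnS => cn.
have [->|ab] := eqVneq a b; first by rewrite D0 dist_ge0.
have [c bc|nbet] := pickP (between d a b); last first.
  by apply: Dadj; split=> // c; rewrite nbet.
have smaller (P : pred X) : {subset P <= between d a b} -> ~~ P c -> (#|P| < n)%N.
  move=> sP nPc; apply: leq_trans cn; apply: proper_card; apply/properP.
  by split; [exact/subsetP | exists c].
have /and3P[_ _ /eqP ->] := bc.
apply: le_trans (Dtri a c b) _; apply: lerD; apply: IHn; apply: smaller.
- by move=> x; apply: between_left.
- by rewrite /between eqxx !andbF.
- by move=> x; apply: between_right.
- by rewrite /between eqxx.
Qed.

End Geodesics.

(** With [s] the inverse of [tau], the function [d' (s a) (s b)] satisfies the
triangle inequality and agrees with [d] on adjacent pairs. *)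
Lemma dist_le_pullback (R : realType) (X X' : finType)
    (d : quasiMetric R X) (d' : quasiMetric R X') (tau : X' -> X) :
  (forall a, exists y, tau y = a) -> injective tau ->
  (forall a b, adjacent d a b ->
     exists y y', [/\ tau y = a, tau y' = b & d' y y' = d a b]) ->
  forall y y', d' y y' <= d (tau y) (tau y').
Proof.
move=> surj inj edges; have [s sK] := choice surj.
have tauK : cancel tau s by move=> y; apply: inj; rewrite sK.
move=> y y'; rewrite -{1}[y]tauK -{1}[y']tauK.
apply: (le_dist_of_adjacent (D := fun a b => d' (s a) (s b))).
- by move=> a; apply/dist_eq0.
- by move=> a b c; apply: dist_triangle.
- by move=> a b /edges[z [z' [<- <- <-]]]; rewrite !tauK.
Qed.

(** Summing over all pairs, the two inequalities bound the total distances of [X]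
and [X'] by each other, so the totals agree and no termwise inequality is
strict. *)
Lemma isometric_of_expanding (R : realType) (X X' : finType)
    (d : quasiMetric R X) (d' : quasiMetric R X')
    (tau : X' -> X) (tau' : X -> X') :
  injective tau -> injective tau' ->
  (forall y y', d' y y' <= d (tau y) (tau y')) ->
  (forall x x', d x x' <= d' (tau' x) (tau' x')) ->
  isometric d d'.
Proof.
move=> inj inj' le le'.
have cardXX' : #|X| = #|X'|.
  by apply/eqP; rewrite eqn_leq (leq_card _ inj) (leq_card _ inj').
have bij : bijective tau by apply: inj_card_bij; rewrite ?cardXX'.
have bij' : bijective tau' by apply: inj_card_bij; rewrite ?cardXX'.
have total (I J : finType) (D : I -> I -> R) (t : J -> I) : bijective t ->
    \sum_(p : J * J) D (t p.1) (t p.2) = \sum_(p : I * I) D p.1 p.2.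
  case=> u tu ut; rewrite [RHS](reindex (fun p : J * J => (t p.1, t p.2))) //=.
  exists (fun p : I * I => (u p.1, u p.2)) => -[i j] _ /=; rewrite ?tu ?ut //.
exists tau'; split=> // a b.
have sumle : \sum_(p : X * X) (d' (tau' p.1) (tau' p.2) - d p.1 p.2) <= 0.
  rewrite sumrB subr_le0 (total _ _ d' _ bij') -(total _ _ d _ bij).
  by apply: ler_sum => p _; apply: le.
have ge0 (p : X * X) : true -> 0 <= d' (tau' p.1) (tau' p.2) - d p.1 p.2.
  by rewrite subr_ge0.
have /eqP := le_anti (introT andP (conj sumle (sumr_ge0 _ ge0))).
rewrite psumr_eq0 // => /allP/(_ (a, b)); rewrite mem_index_enum => /(_ isT).
by rewrite /= subr_eq0 => /eqP.
Qed.

(** * Reconstruction of the space *)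

Lemma MH_ring_iso_sym (R : realType) (X X' : choiceType)
    (d : quasiMetric R X) (d' : quasiMetric R X') :
  MH_ring_iso d d' -> MH_ring_iso d' d.
Proof.
case=> f [f_bij f_unit f_mul].
have inv k l : {g : {additive MH d' k l -> MH d k l} |
    cancel (f k l) g /\ cancel g (f k l)}.
  apply: cid; have [g fg gf] := f_bij k l.
  pose gM := GRing.isZmodMorphism.Build _ _ g (can2_zmod_morphism fg gf).
  pose ga : {additive MH d' k l -> MH d k l} := HB.pack g gM.
  by exists ga.
exists (fun k l => sval (inv k l)); split=> [k l||k1 k2 l1 l2 x y].
- by have [fg gf] := svalP (inv k l); exists (f k l).
- by have [fg gf] := svalP (inv 0%N (zeronng R)); rewrite -f_unit fg.
have [fg _] := svalP (inv (k1 + k2)%N (addnng l1 l2)).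
have [_ gf1] := svalP (inv k1 l1); have [_ gf2] := svalP (inv k2 l2).
by rewrite -{1}[x]gf1 -{1}[y]gf2 -f_mul fg.
Qed.

Lemma MH_ring_iso_edges_lift (R : realType) (X X' : finType)
    (d : quasiMetric R X) (d' : quasiMetric R X') :
  MH_ring_iso d d' -> exists tau : X' -> X,
  (forall a, exists y, tau y = a) /\
  forall a b, adjacent d a b ->
    exists y y', [/\ tau y = a, tau y' = b & d' y y' = d a b].
Proof.
case=> f [f_bij f_unit f_mul]; apply: (edges_lift (f := f)) => //.
by move=> k l; apply: bij_inj.
Qed.

Lemma surj_card_inj (X X' : finType) (tau : X' -> X) :
  (forall a, exists y, tau y = a) ->
  (#|X| <= #|X'|)%N /\ ((#|X'| <= #|X|)%N -> injective tau).
Proof.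
move=> surj; have [s sK] := choice surj.
have s_inj : injective s by apply: can_inj sK.
split=> [|le]; first exact: leq_card s_inj.
have sM := (bij_can_sym (inj_card_bij s_inj le) tau).2 sK.
exact: can_inj sM.
Qed.

Theorem corollary3p2 (R : realType) (X X' : finType)
  (d : quasiMetric R X) (d' : quasiMetric R X') :
  MH_ring_iso d d' -> isometric d d'.
Proof.
move=> iso; have [tau [surj edges]] := MH_ring_iso_edges_lift iso.
have [tau' [surj' edges']] := MH_ring_iso_edges_lift (MH_ring_iso_sym iso).
have [le_card inj_tau] := surj_card_inj surj.
have [le_card' inj_tau'] := surj_card_inj surj'.
apply: (isometric_of_expanding (tau := tau) (tau' := tau')).
- exact: inj_tau.
- exact: inj_tau'.
- exact: dist_le_pullback surj (inj_tau _) edges.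
- exact: dist_le_pullback surj' (inj_tau' _) edges'.
Qed.
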